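(* Fix an extended type $\tau=(\tau_1,\tau_2)$. Let $\mathbf{Lat}^*$ be the category of complete lattices with morphisms the maps preserving $0,1$, arbitrary joins and arbitrary meets; let $\mathbf{Rel}^{\uparrow}_\tau$ be the category of ordered extended relational structures of type $\tau$ with order $p$-morphisms; and let $\mathbf{Alg}_\tau$ be the category of bounded lattices with additional operations of types $\tau_1$ and $\tau_2$ and their homomorphisms. Then there is a bifunctor $\mathbf{Lat}^*\times\mathbf{Rel}^{\uparrow}_\tau\to\mathbf{Alg}_\tau$, covariant in the first argument and contravariant in the second, that takes $(L,\mathfrak{X})$ to the ordered extended convolution algebra $L^{\mathfrak{X}\uparrow}$, a morphism $\phi:L\to M$ to $\alpha\mapsto\phi\circ\alpha$, and an order $p$-morphism $p:\mathfrak{X}\to\mathfrak{Y}$ to $\beta\mapsto\beta\circ p$ from $L^{\mathfrak{Y}\uparrow}$ to $L^{\mathfrak{X}\uparrow}$.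
   Context: An extended type is $\tau=(\tau_1,\tau_2)$ with $\tau_1:I\to\mathbb{N}$, $\tau_2:J\to\mathbb{N}$. An ordered extended relational structure is $\mathfrak{X}=(X,\le,(R_i)_{i\in I},(S_j)_{j\in J})$ with $\le$ a partial order on $X$, $R_i\subseteq X^{n_i+1}$, $S_j\subseteq X^{n_j+1}$, such that if $(x_1,\ldots,x_{n_i},x)\in R_i$ and $x\le y$ then $(x_1,\ldots,x_{n_i},y)\in R_i$, and if $(x_1,\ldots,x_{n_j},x)\in S_j$ and $y\le x$ then $(x_1,\ldots,x_{n_j},y)\in S_j$. For a complete lattice $L$, $L^{\mathfrak{X}\uparrow}$ is the set of order-preserving functions $X\to L$ with pointwise $\wedge,\vee,0,1$ and operations $f_i(\alpha_1,\ldots,\alpha_{n_i})(x)=\bigvee\{\alpha_1(x_1)\wedge\cdots\wedge\alpha_{n_i}(x_{n_i}):(x_1,\ldots,x_{n_i},x)\in R_i\}$ and $g_j(\alpha_1,\ldots,\alpha_{n_j})(x)=\bigwedge\{\alpha_1(x_1)\vee\cdots\vee\alpha_{n_j}(x_{n_j}):(x_1,\ldots,x_{n_j},x)\in S_j\}$. An order $p$-morphism is an order-preserving map $p:X\to Y$ such that for every relation (of either family) $T$ on $X$ with corresponding $T'$ on $Y$, of arity $n+1$, and each $x\in X$: $\{(y_1,\ldots,y_n):(y_1,\ldots,y_n,p(x))\in T'\}=\{(p(x_1),\ldots,p(x_n)):(x_1,\ldots,x_n,x)\in T\}$. *)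

(* Defs.v *)
From HB Require Import structures.
From mathcomp Require Import all_boot all_order.
From mathcomp Require Import boolp classical_sets.

Set Implicit Arguments.
Unset Strict Implicit.
Unset Printing Implicit Defensive.

Import Order.TTheory.

Local Open Scope classical_set_scope.
Local Open Scope order_scope.

(* Morphisms are compared with Leibniz equality; all the categories below are
   concrete and their morphisms are equal as soon as the underlying functions
   are extensionally equal. *)
Record category := Category {
  obj :> Type;
  hom : obj -> obj -> Type;
  idm : forall a, hom a a;
  comp : forall a b c, hom b c -> hom a b -> hom a c;
  comp_idl : forall a b (f : hom a b), comp (idm b) f = f;
  comp_idr : forall a b (f : hom a b), comp f (idm a) = f;
  comp_assoc : forall a b c d (h : hom c d) (g : hom b c) (f : hom a b),
    comp h (comp g f) = comp (comp h g) f }.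

Arguments hom {_} _ _.
Arguments idm {_} _.
Arguments comp {_ _ _ _} _ _.

Definition op_category (C : category) : category :=
  @Category C (fun a b => hom b a) (fun a => idm a)
    (fun a b c g f => comp f g)
    (fun a b f => comp_idr f) (fun a b f => comp_idl f)
    (fun a b c d h g f => esym (comp_assoc f g h)).

Section ProdCategory.
Variables C D : category.

Definition prod_hom (a b : C * D) : Type := (hom a.1 b.1 * hom a.2 b.2)%type.

Definition prod_idm (a : C * D) : prod_hom a a := (idm a.1, idm a.2).

Definition prod_comp (a b c : C * D) (g : prod_hom b c) (f : prod_hom a b) :
  prod_hom a c := (comp g.1 f.1, comp g.2 f.2).

Lemma prod_comp_idl a b (f : prod_hom a b) : prod_comp (prod_idm b) f = f.
Proof. by case: f => f1 f2; rewrite /prod_comp /= !comp_idl. Qed.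

Lemma prod_comp_idr a b (f : prod_hom a b) : prod_comp f (prod_idm a) = f.
Proof. by case: f => f1 f2; rewrite /prod_comp /= !comp_idr. Qed.

Lemma prod_comp_assoc a b c d
    (h : prod_hom c d) (g : prod_hom b c) (f : prod_hom a b) :
  prod_comp h (prod_comp g f) = prod_comp (prod_comp h g) f.
Proof. by rewrite /prod_comp /= !comp_assoc. Qed.

Definition prod_category : category :=
  Category prod_comp_idl prod_comp_idr prod_comp_assoc.

End ProdCategory.

(* A functor whose object map is the given [F0]: indexing by the object map
   lets one say which objects a functor produces without transporting
   morphisms along equalities between objects. *)
Record functor (C D : category) (F0 : C -> D) := Functor {
  fmap : forall a b : C, hom a b -> hom (F0 a) (F0 b);
  fmap_id : forall a : C, fmap (idm a) = idm (F0 a);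
  fmap_comp : forall (a b c : C) (g : hom b c) (f : hom a b),
    fmap (comp g f) = comp (fmap g) (fmap f) }.

Arguments fmap {_ _ _} _ {_ _} _.

(* Covariant in [C], contravariant in [D]. *)
Definition bifunctor (C D E : category) (F0 : C -> D -> E) :=
  @functor (prod_category C (op_category D)) E (fun a => F0 a.1 a.2).

Definition bimap (C D E : category) (F0 : C -> D -> E) (F : bifunctor F0)
    (a a' : C) (b b' : D) (f : hom a a') (g : hom b' b) :
    hom (F0 a b) (F0 a' b') :=
  @fmap _ _ _ F (a, b) (a', b') (f, g).

HB.mixin Record TBLattice_isComplete d T of Order.TBLattice d T := {
  supremums_neq0 : forall A : set T, supremums A !=set0;
  infimums_neq0 : forall A : set T, infimums A !=set0 }.

#[short(type="completeLatticeType")]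
HB.structure Definition CompleteLattice d :=
  { T of TBLattice_isComplete d T & Order.TBLattice d T }.

Section CompleteLatticeTheory.
Context {d : Order.disp_t} {L : completeLatticeType d}.
Implicit Types (A : set L) (x y : L).

(* The library's [supremum x0 A] is the default [x0] when [A] is empty, hence
   the choice of [\bot]; dually for [infimum]. *)
Definition bigsup A : L := supremum \bot A.
Definition biginf A : L := infimum \top A.

Lemma bigsupP A : supremums A (bigsup A).
Proof.
rewrite /bigsup /supremum; case: ifPn => [/eqP -> | _].
  by split=> [x []|x _]; exact: le0x.
by case: (supremums_neq0 A) => x Ax; case: xgetP => // /(_ x).
Qed.

Lemma biginfP A : infimums A (biginf A).
Proof.
rewrite /biginf /infimum; case: ifPn => [/eqP -> | _].
  by split=> [x []|x _]; exact: lex1.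
by case: (infimums_neq0 A) => x Ax; case: xgetP => // /(_ x).
Qed.

Lemma le_bigsup A B : A `<=` B -> bigsup A <= bigsup B.
Proof. by move=> AB; apply: (bigsupP A).2 => x /AB; exact: (bigsupP B).1. Qed.

Lemma le_biginf A B : A `<=` B -> biginf B <= biginf A.
Proof. by move=> AB; apply: (biginfP A).2 => x /AB; exact: (biginfP B).1. Qed.

End CompleteLatticeTheory.

Record lat := Lat {
  lat_disp : Order.disp_t;
  lat_sort :> completeLatticeType lat_disp }.

Record lat_hom (L M : lat) := LatHom {
  lat_fun :> L -> M;
  lat_fun0 : lat_fun \bot = \bot;
  lat_fun1 : lat_fun \top = \top;
  lat_fun_sup : forall A : set L, lat_fun (bigsup A) = bigsup (lat_fun @` A);
  lat_fun_inf : forall A : set L, lat_fun (biginf A) = biginf (lat_fun @` A) }.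

Lemma lat_hom_eq (L M : lat) (f g : lat_hom L M) : f =1 g -> f = g.
Proof.
case: f g => [f f0 f1 fs fi] [g g0 g1 gs gi] /= /funext fg.
rewrite -{}fg in g0 g1 gs gi *.
by congr LatHom; exact: Prop_irrelevance.
Qed.

Definition lat_id (L : lat) : lat_hom L L.
Proof. by exists (fun x => x) => // A; rewrite image_id. Defined.

Definition lat_comp (L M N : lat) (g : lat_hom M N) (f : lat_hom L M) :
  lat_hom L N.
Proof.
exists (fun x => g (f x)).
- by rewrite lat_fun0 lat_fun0.
- by rewrite lat_fun1 lat_fun1.
- by move=> A; rewrite 2!lat_fun_sup image_comp.
- by move=> A; rewrite 2!lat_fun_inf image_comp.
Defined.

Definition LatStar : category.
Proof.
by apply: (@Category lat lat_hom lat_id lat_comp) => *; exact: lat_hom_eq.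
Defined.

Record ext_type := ExtType {
  idxI : Type;
  idxJ : Type;
  tau1 : idxI -> nat;
  tau2 : idxJ -> nat }.

Record rel_struct (tau : ext_type) := RelStruct {
  rs_disp : Order.disp_t;
  rs_sort :> porderType rs_disp;
  rs_R : forall i : idxI tau, set ((tau1 i).+1.-tuple rs_sort);
  rs_S : forall j : idxJ tau, set ((tau2 j).+1.-tuple rs_sort);
  rs_R_up : forall i (xs : (tau1 i).-tuple rs_sort) (x y : rs_sort),
    @rs_R i [tuple of rcons xs x] -> x <= y -> @rs_R i [tuple of rcons xs y];
  rs_S_down : forall j (xs : (tau2 j).-tuple rs_sort) (x y : rs_sort),
    @rs_S j [tuple of rcons xs x] -> y <= x -> @rs_S j [tuple of rcons xs y] }.

Arguments rs_R {tau} X i _ : rename.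
Arguments rs_S {tau} X j _ : rename.

(* [rel_fiber T x] is the set of all (x_1,...,x_n) with (x_1,...,x_n,x) in T. *)
Definition rel_fiber (X : Type) n (T : set (n.+1.-tuple X)) (x : X) :
  set (n.-tuple X) := [set xs : n.-tuple X | T [tuple of rcons xs x]].

Record pmorphism (tau : ext_type) (X Y : rel_struct tau) := PMorphism {
  pm_fun :> {omorphism X -> Y};
  pm_R : forall (i : idxI tau) (x : X),
    rel_fiber (rs_R Y i) (pm_fun x) =
    [set [tuple of map pm_fun xs] | xs in rel_fiber (rs_R X i) x];
  pm_S : forall (j : idxJ tau) (x : X),
    rel_fiber (rs_S Y j) (pm_fun x) =
    [set [tuple of map pm_fun xs] | xs in rel_fiber (rs_S X j) x] }.

Lemma omorphism_eq d d' (X : porderType d) (Y : porderType d')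
  (f g : {omorphism X -> Y}) : f =1 g -> f = g.
Proof.
case: f g => [f [[fP]]] [g [[gP]]] /= /funext fg.
by rewrite -{}fg in gP *; rewrite (Prop_irrelevance fP gP).
Qed.

Lemma pmorphism_eq tau (X Y : rel_struct tau) (p q : pmorphism X Y) :
  p =1 q -> p = q.
Proof.
case: p q => [p pR pS] [q qR qS] /= /omorphism_eq pq.
rewrite -{}pq in qR qS *.
by congr PMorphism; exact: Prop_irrelevance.
Qed.

Definition pm_id tau (X : rel_struct tau) : pmorphism X X.
Proof.
exists (idfun : {omorphism X -> X}) => [i x|j x];
  by rewrite -[LHS]image_id; apply: eq_imagel => xs _; apply/val_inj;
     rewrite /= map_id.
Defined.

Definition pm_comp tau (X Y Z : rel_struct tau)
  (q : pmorphism Y Z) (p : pmorphism X Y) : pmorphism X Z.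
Proof.
exists (q \o p : {omorphism X -> Z}) => [i x|j x] /=.
- rewrite pm_R pm_R image_comp; apply: eq_imagel => xs _.
  by apply/val_inj; rewrite /= map_comp.
- rewrite pm_S pm_S image_comp; apply: eq_imagel => xs _.
  by apply/val_inj; rewrite /= map_comp.
Defined.

Definition RelUp (tau : ext_type) : category.
Proof.
by apply: (@Category (rel_struct tau) (@pmorphism tau) (@pm_id tau)
  (@pm_comp tau)) => *; exact: pmorphism_eq.
Defined.

Record alg (tau : ext_type) := Algebra {
  alg_disp : Order.disp_t;
  alg_sort :> tbLatticeType alg_disp;
  alg_f : forall i : idxI tau, (tau1 i).-tuple alg_sort -> alg_sort;
  alg_g : forall j : idxJ tau, (tau2 j).-tuple alg_sort -> alg_sort }.

(* The library's [{tblmorphism _ -> _}] only requires preservation of [\bot] and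
   [\top], hence [{lmorphism _ -> _}] with the two constants stated apart. *)
Record alg_hom (tau : ext_type) (A B : alg tau) := AlgHom {
  alg_fun :> {lmorphism A -> B};
  alg_fun0 : alg_fun \bot = \bot;
  alg_fun1 : alg_fun \top = \top;
  alg_fun_f : forall (i : idxI tau) (t : (tau1 i).-tuple A),
    alg_fun (alg_f t) = alg_f [tuple of map alg_fun t];
  alg_fun_g : forall (j : idxJ tau) (t : (tau2 j).-tuple A),
    alg_fun (alg_g t) = alg_g [tuple of map alg_fun t] }.

Lemma lmorphism_eq d d' (X : latticeType d) (Y : latticeType d')
  (f g : {lmorphism X -> Y}) : f =1 g -> f = g.
Proof.
case: f g => [f [[fI] [fP] [fU]]] [g [[gI] [gP] [gU]]].
move=> /= /funext fg; rewrite -{}fg in gP gI gU *.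
by rewrite (Prop_irrelevance fP gP) (Prop_irrelevance fI gI)
  (Prop_irrelevance fU gU).
Qed.

Definition lmorphism_comp d d' d'' (X : latticeType d) (Y : latticeType d')
    (Z : latticeType d'') (g : {lmorphism Y -> Z}) (f : {lmorphism X -> Y}) :
    {lmorphism X -> Z} :=
  HB.pack (g \o f) (Order.isOrderMorphism.Build d X d'' Z (g \o f)
      (fun x y xy => omorph_le g (omorph_le f xy)))
    (Order.isLatticeMorphism.Build d X d'' Z (g \o f)
      (comp_is_meet_morphism g f) (comp_is_join_morphism g f)).

Lemma alg_hom_eq tau (A B : alg tau) (f g : alg_hom A B) : f =1 g -> f = g.
Proof.
case: f g => [f f0 f1 ff fg] [g g0 g1 gf gg] /= /lmorphism_eq e.
rewrite -{}e in g0 g1 gf gg *.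
by congr AlgHom; exact: Prop_irrelevance.
Qed.

Definition alg_id tau (A : alg tau) : alg_hom A A.
Proof.
by exists (idfun : {lmorphism A -> A}) => // [i t|j t] /=; congr (_ _);
  apply/val_inj; rewrite /= map_id.
Defined.

Definition alg_comp tau (A B C : alg tau) (g : alg_hom B C) (f : alg_hom A B) :
  alg_hom A C.
Proof.
exists (lmorphism_comp g f) => [||i t|j t] /=.
- by rewrite !alg_fun0.
- by rewrite !alg_fun1.
- by rewrite !alg_fun_f; congr (_ _); apply/val_inj; rewrite /= map_comp.
- by rewrite !alg_fun_g; congr (_ _); apply/val_inj; rewrite /= map_comp.
Defined.

Definition Alg (tau : ext_type) : category.
Proof.
by apply: (@Category (alg tau) (@alg_hom tau) (@alg_id tau) (@alg_comp tau))
  => *; exact: alg_hom_eq.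
Defined.

Section OrderPreservingFunctions.
Context {d d' : Order.disp_t} {X : porderType d}.

Section POrder.
Variable L : porderType d'.

HB.instance Definition _ := gen_eqMixin {omorphism X -> L}.
HB.instance Definition _ := gen_choiceMixin {omorphism X -> L}.

Implicit Types a b : {omorphism X -> L}.

Definition om_le a b : bool := `[< forall x, a x <= b x >].

Fact om_le_refl : reflexive om_le.
Proof. by move=> a; apply/asboolP. Qed.

Fact om_le_anti : antisymmetric om_le.
Proof.
move=> a b /andP[/asboolP ab /asboolP ba]; apply: omorphism_eq => x.
by apply/le_anti; rewrite ab ba.
Qed.

Fact om_le_trans : transitive om_le.
Proof.
move=> b a c /asboolP ab /asboolP bc; apply/asboolP => x.
exact: le_trans (ab x) (bc x).
Qed.

HB.instance Definition _ := Order.Le_isPOrder.Build FunOrder.fun_display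
  {omorphism X -> L} om_le_refl om_le_anti om_le_trans.

End POrder.

Section TBLattice.
Variable L : tbLatticeType d'.
Implicit Types a b c : {omorphism X -> L}.

Definition om_mk (f : X -> L) (fP : {homo f : x y / x <= y}) :
    {omorphism X -> L} :=
  HB.pack f (Order.isOrderMorphism.Build d X d' L f fP).

Definition om_meet a b : {omorphism X -> L} := @om_mk (fun x => a x `&` b x)
  (fun x y xy => leI2 (omorph_le a xy) (omorph_le b xy)).
Definition om_join a b : {omorphism X -> L} := @om_mk (fun x => a x `|` b x)
  (fun x y xy => leU2 (omorph_le a xy) (omorph_le b xy)).
Definition om_bot : {omorphism X -> L} := @om_mk (fun=> \bot)
  (fun x y xy => lexx \bot).
Definition om_top : {omorphism X -> L} := @om_mk (fun=> \top)
  (fun x y xy => lexx \top).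

Fact om_meetP a b c : (a <= om_meet b c) = (a <= b) && (a <= c).
Proof.
apply/asboolP/andP => [abc|[/asboolP ab /asboolP ac] x].
  by split; apply/asboolP => x; move: (abc x); rewrite lexI => /andP[].
by rewrite lexI ab ac.
Qed.

Fact om_joinP a b c : (om_join a b <= c) = (a <= c) && (b <= c).
Proof.
apply/asboolP/andP => [abc|[/asboolP ac /asboolP bc] x].
  by split; apply/asboolP => x; move: (abc x); rewrite leUx => /andP[].
by rewrite leUx ac bc.
Qed.

Fact om_le0x a : om_bot <= a.
Proof. by apply/asboolP => x; exact: le0x. Qed.

Fact om_lex1 a : a <= om_top.
Proof. by apply/asboolP => x; exact: lex1. Qed.

HB.instance Definition _ := Order.POrder_MeetJoin_isLattice.Build FunOrder.fun_display
  {omorphism X -> L} om_meetP om_joinP.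
HB.instance Definition _ := Order.hasBottom.Build FunOrder.fun_display
  {omorphism X -> L} om_le0x.
HB.instance Definition _ := Order.hasTop.Build FunOrder.fun_display
  {omorphism X -> L} om_lex1.

End TBLattice.
End OrderPreservingFunctions.

Section ConvolutionAlgebra.
Variables (tau : ext_type) (L : lat) (X : rel_struct tau).

Definition conv_f_fun (i : idxI tau)
    (t : (tau1 i).-tuple {omorphism X -> L}) (x : X) : L :=
  bigsup [set \meet_(k < tau1 i) (tnth t k) (tnth xs k)
         | xs in rel_fiber (rs_R X i) x].

Definition conv_g_fun (j : idxJ tau)
    (t : (tau2 j).-tuple {omorphism X -> L}) (x : X) : L :=
  biginf [set \join_(k < tau2 j) (tnth t k) (tnth xs k)
         | xs in rel_fiber (rs_S X j) x].

Fact conv_f_homo i t : {homo @conv_f_fun i t : x y / x <= y}.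
Proof.
move=> x y xy; apply: le_bigsup; apply: image_subset => xs /= Rx.
exact: rs_R_up Rx xy.
Qed.

Fact conv_g_homo j t : {homo @conv_g_fun j t : x y / x <= y}.
Proof.
move=> x y xy; apply: le_biginf; apply: image_subset => xs /= Sy.
exact: rs_S_down Sy xy.
Qed.

Definition conv_alg : alg tau :=
  @Algebra tau FunOrder.fun_display {omorphism X -> L}
    (fun i t => om_mk (@conv_f_homo i t))
    (fun j t => om_mk (@conv_g_homo j t)).

End ConvolutionAlgebra.

(* Main.v *)
From HB Require Import structures.
Require Import Defs.
From mathcomp Require Import all_boot all_order.
From mathcomp Require Import classical_sets.

(** The joint action of a pair (phi, p) is alpha |-> phi \o alpha \o p. At a
    point x, its compatibility with the operations combines two facts: phi
    commutes with the joins and meets defining them, and the p-morphism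
    condition turns the index set at p x into the image under p of the index
    set at x. *)

Set Implicit Arguments.
Unset Strict Implicit.
Unset Printing Implicit Defensive.

Import Order.TTheory.

Local Open Scope classical_set_scope.
Local Open Scope order_scope.

(** Morphisms of [LatStar] are only given to preserve [biginf] and [bigsup]; writing binary meets
    and joins as bounds of pairs transfers preservation to them. *)
Lemma biginf2 d (L : completeLatticeType d) (x y : L) :
  biginf [set x; y] = x `&` y.
Proof.
have [lb glb] := biginfP [set x; y].
apply/le_anti/andP; split; first by rewrite lexI !lb //=; [right|left].
by apply: glb => _ [->|->]; [exact: leIl|exact: leIr].
Qed.

Lemma bigsup2 d (L : completeLatticeType d) (x y : L) :
  bigsup [set x; y] = x `|` y.
Proof.
have [ub lub] := bigsupP [set x; y].
apply/le_anti/andP; split; last by rewrite leUx !ub //=; [right|left].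
by apply: lub => _ [->|->]; [exact: leUl|exact: leUr].
Qed.

Lemma lat_fun_meet (L M : lat) (phi : lat_hom L M) :
  {morph phi : x y / x `&` y}.
Proof. by move=> x y; rewrite -!biginf2 lat_fun_inf image_setU !image_set1. Qed.

Lemma lat_fun_join (L M : lat) (phi : lat_hom L M) :
  {morph phi : x y / x `|` y}.
Proof. by move=> x y; rewrite -!bigsup2 lat_fun_sup image_setU !image_set1. Qed.

Lemma lat_fun_homo (L M : lat) (phi : lat_hom L M) :
  {homo phi : x y / x <= y}.
Proof. by move=> x y /meet_idPl xy; rewrite -xy lat_fun_meet leIr. Qed.

Section ConvolutionMap.
Variables (tau : ext_type) (L M : lat) (X Y : rel_struct tau).
Variables (phi : lat_hom L M) (p : pmorphism X Y).

(** Both arguments act in one map, so no interchange law between separate actions of [phi] and [p]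
    has to be checked. *)
Definition conv_map_fun (alpha : {omorphism Y -> L}) : {omorphism X -> M} :=
  om_mk (fun x y xy => lat_fun_homo phi (omorph_le alpha (omorph_le p xy))).

Lemma conv_map_funI : {morph conv_map_fun : a b / a `&` b}.
Proof. by move=> a b; apply: omorphism_eq => x; exact: lat_fun_meet. Qed.

Lemma conv_map_funU : {morph conv_map_fun : a b / a `|` b}.
Proof. by move=> a b; apply: omorphism_eq => x; exact: lat_fun_join. Qed.

Lemma conv_map_fun_homo : {homo conv_map_fun : a b / a <= b}.
Proof. by move=> a b /meet_idPl ab; rewrite -ab conv_map_funI leIr. Qed.

HB.instance Definition _ := Order.isOrderMorphism.Build
  _ {omorphism Y -> L} _ {omorphism X -> M} conv_map_fun conv_map_fun_homo.
HB.instance Definition _ := Order.isLatticeMorphism.Build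
  _ {omorphism Y -> L} _ {omorphism X -> M} conv_map_fun
  conv_map_funI conv_map_funU.

Definition conv_map : alg_hom (conv_alg L Y) (conv_alg M X).
Proof.
exists (conv_map_fun : {lmorphism {omorphism Y -> L} -> {omorphism X -> M}}).
- by apply: omorphism_eq => x; exact: lat_fun0.
- by apply: omorphism_eq => x; exact: lat_fun1.
- move=> i t; apply: omorphism_eq => x.
  rewrite /= /conv_f_fun lat_fun_sup pm_R !image_comp.
  (* Both suprema now range over the fiber of [X] at [x], so it suffices to compare the terms for
     each [xs]. *)
  congr bigsup; apply: eq_imagel => xs _ /=.
  (* Preservation of [\top] covers the empty meet, which occurs at arity 0. *)
  rewrite (big_morph phi (lat_fun_meet phi) (lat_fun1 phi)).
  by apply: eq_bigr => k _; rewrite !tnth_map.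
- move=> j t; apply: omorphism_eq => x.
  rewrite /= /conv_g_fun lat_fun_inf pm_S !image_comp.
  congr biginf; apply: eq_imagel => xs _ /=.
  (* Dually, the empty join is [\bot]. *)
  rewrite (big_morph phi (lat_fun_join phi) (lat_fun0 phi)).
  by apply: eq_bigr => k _; rewrite !tnth_map.
Defined.

End ConvolutionMap.

(** Both functor laws hold pointwise by computation, since composition of functions is associative
    and unital up to conversion. The definition stays transparent so that [bimap] unfolds to
    [conv_map]. *)
Definition conv_bifunctor (tau : ext_type) :
  @bifunctor LatStar (RelUp tau) (Alg tau) (@conv_alg tau).
Proof.
exists (fun (a b : prod_category LatStar (op_category (RelUp tau)))
    (h : hom a b) => conv_map h.1 h.2 : @hom (Alg tau) _ _).
- by move=> a; apply: alg_hom_eq => alpha; exact: omorphism_eq.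
- by move=> a b c g f; apply: alg_hom_eq => alpha; exact: omorphism_eq.
Defined.

Theorem theorem5p21 (tau : ext_type) :
  exists F : @bifunctor LatStar (RelUp tau) (Alg tau) (@conv_alg tau),
    (forall (L M : LatStar) (X : RelUp tau) (phi : lat_hom L M)
        (alpha : {omorphism X -> L}),
      (bimap F phi (idm X) : alg_hom (conv_alg L X) (conv_alg M X)) alpha
      = phi \o alpha :> (X -> M)) /\
    (forall (L : LatStar) (X Y : RelUp tau) (p : pmorphism X Y)
        (beta : {omorphism Y -> L}),
      (bimap F (idm L) p : alg_hom (conv_alg L Y) (conv_alg L X)) beta
      = beta \o p :> (X -> L)).
(* With an identity in one argument, [phi \o alpha \o p] reduces by conversion to the required
   composite. *)
Proof. by exists (conv_bifunctor tau). Qed.
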